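(* Let $A \in L(\mathcal{H})$ have closed range and let $W \in L(\mathcal{H})^{+}$. For $X\in L(\mathcal{H})$ put $F(X)=(AX-I)^{*}W(AX-I)$. Then the infimum of the set $\{F(X): X\in L(\mathcal{H})\}$, with respect to the operator order, exists and $$\inf_{X \in L(\mathcal{H})}F(X)=W_{/R(A)}.$$
   Context: $\mathcal{H}$ is a separable complex Hilbert space, $L(\mathcal{H})$ is the algebra of bounded linear operators on $\mathcal{H}$, $L(\mathcal{H})^{+}$ is the cone of positive semidefinite operators, $I$ is the identity operator, and $R(T)$ denotes the range of $T$. The operator order is: $S\le T$ if $T-S\in L(\mathcal{H})^{+}$; an infimum is a greatest lower bound in this order. For $W\in L(\mathcal{H})^{+}$ and a closed subspace $\mathcal{S}\subseteq\mathcal{H}$, the shorted operator of $W$ to $\mathcal{S}$ is $W_{/\mathcal{S}}=\max\{X\in L(\mathcal{H}): 0\le X\le W \text{ and } R(X)\subseteq \mathcal{S}^{\perp}\}$; this maximum (in the operator order) is known to exist. *)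

(* Defs.v *)
From HB Require Import structures.
From mathcomp Require Import all_boot all_order all_algebra.
From mathcomp Require Import complex.
From mathcomp Require Import all_classical all_reals topology normedtype.

Set Implicit Arguments.
Unset Strict Implicit.
Unset Printing Implicit Defensive.

Import Order.TTheory GRing.Theory Num.Theory.
Import numFieldNormedType.Exports.

Local Open Scope classical_set_scope.
Local Open Scope complex_scope.
Local Open Scope ring_scope.

(** The norm of a module over [R[i]] takes its values in [R[i]]; they are real
    and nonnegative. The inner product is linear in its first argument. *)
HB.mixin Record CompleteNormedModule_isHilbert (R : realType) H
    & CompleteNormedModule R[i] H := {
  inner : {dot H for @Num.conj R[i]};
  sqr_normE : forall x : H, `|x| ^+ 2 = inner x x
}.

#[short(type="hilbertType")]
HB.structure Definition Hilbert (R : realType) :=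
  { H of CompleteNormedModule_isHilbert R H & CompleteNormedModule R[i] H }.

Notation "''[' x , y ]" := (inner x%R y%R) : ring_scope.

Section InnerTheory.
Context {R : realType} {H : hilbertType R}.
Implicit Types x y z : H.

Lemma innerDl x y z : '[x + y, z] = '[x, z] + '[y, z].
Proof. exact: linearDl. Qed.
Lemma innerDr x y z : '[x, y + z] = '[x, y] + '[x, z].
Proof. exact: linearDr. Qed.
Lemma innerNl x y : '[- x, y] = - '[x, y].
Proof. exact: linearNl. Qed.
Lemma inner0l x : '[0, x] = 0.
Proof. exact: linear0l. Qed.
Lemma innerZl (a : R[i]) x y : '[a *: x, y] = a * '[x, y].
Proof. exact: linearZl_LR. Qed.
Lemma innerZr (a : R[i]) x y : '[x, a *: y] = Num.conj a * '[x, y].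
Proof. exact: linearZr_LR. Qed.
Lemma innerC x y : '[x, y] = Num.conj '[y, x].
Proof. by rewrite (hermC inner) expr0 mul1r. Qed.
Lemma inner_eq0 x : ('[x, x] == 0) = (x == 0).
Proof. by rewrite -sqr_normE expf_eq0/= normr_eq0. Qed.

End InnerTheory.

Definition separable (T : topologicalType) : Prop :=
  exists2 D : set T, countable D & dense D.

(** Continuity of a linear map is equivalent to boundedness, see
    [linear_bounded_continuous]. *)
#[short(type="boundedOp")]
HB.structure Definition BoundedOp (R : realType) (H : hilbertType R) :=
  { f of @GRing.Linear R[i] H H *:%R f & @Continuous H H f }.

Section BoundedOpRing.
Context {R : realType} {H : hilbertType R}.
Implicit Types S T U : boundedOp H.

HB.instance Definition _ := gen_eqMixin (boundedOp H).
HB.instance Definition _ := gen_choiceMixin (boundedOp H).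

Lemma boundedOpP S T : S =1 T -> S = T.
Proof.
case: S => f [[fz] [fs] [fc]]; case: T => g [[gz] [gs] [gc]] /= /funext fg.
by subst g; rewrite (Prop_irrelevance fz gz) (Prop_irrelevance fs gs)
  (Prop_irrelevance fc gc).
Qed.

Section Make.
Variables (f : H -> H) (lf : linear f) (cf : continuous f).
Definition mk_boundedOp of linear f & continuous f := f.
HB.instance Definition _ :=
  GRing.isLinear.Build R[i] H H *:%R (mk_boundedOp lf cf) lf.
HB.instance Definition _ := isContinuous.Build H H (mk_boundedOp lf cf) cf.
Definition BoundedOpOf : boundedOp H := mk_boundedOp lf cf.
End Make.

Fact zero_linear : linear (fun _ : H => 0 : H).
Proof. by move=> a x y; rewrite scaler0 addr0. Qed.
Fact zero_continuous : continuous (fun _ : H => 0 : H).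
Proof. by move=> x; exact: cvg_cst. Qed.
Definition zero_op := BoundedOpOf zero_linear zero_continuous.

Fact id_linear : linear (fun x : H => x).
Proof. by []. Qed.
Fact id_continuous : continuous (fun x : H => x).
Proof. by move=> x; exact: cvg_id. Qed.
Definition id_op := BoundedOpOf id_linear id_continuous.

Fact add_linear S T : linear (fun x => S x + T x).
Proof. by move=> a x y; rewrite !linearP scalerDr addrACA. Qed.
Fact add_op_continuous S T : continuous (fun x => S x + T x).
Proof. by move=> x; apply: cvgD; exact: cts_fun. Qed.
Definition add_op S T := BoundedOpOf (@add_linear S T) (@add_op_continuous S T).

Fact opp_linear S : linear (fun x => - S x).
Proof. by move=> a x y; rewrite linearP opprD scalerN. Qed.
Fact opp_op_continuous S : continuous (fun x => - S x).
Proof. by move=> x; apply: cvgN; exact: cts_fun. Qed.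
Definition opp_op S := BoundedOpOf (@opp_linear S) (@opp_op_continuous S).

Fact comp_linear S T : linear (fun x => S (T x)).
Proof. by move=> a x y; rewrite !linearP. Qed.
Fact comp_op_continuous S T : continuous (fun x => S (T x)).
Proof. by move=> x; apply: (@continuous_comp _ _ _ T S); exact: cts_fun. Qed.
Definition comp_op S T := BoundedOpOf (@comp_linear S T) (@comp_op_continuous S T).

Fact add_opA : associative add_op.
Proof. by move=> S T U; apply: boundedOpP => x; exact: addrA. Qed.
Fact add_opC : commutative add_op.
Proof. by move=> S T; apply: boundedOpP => x; exact: addrC. Qed.
Fact add_0op : left_id zero_op add_op.
Proof. by move=> S; apply: boundedOpP => x; exact: add0r. Qed.
Fact add_Nop : left_inverse zero_op opp_op add_op.
Proof. by move=> S; apply: boundedOpP => x; exact: addNr. Qed.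
HB.instance Definition _ :=
  GRing.isZmodule.Build (boundedOp H) add_opA add_opC add_0op add_Nop.

Fact comp_opA : associative comp_op.
Proof. by move=> S T U; exact: boundedOpP. Qed.
Fact comp_1op : left_id id_op comp_op.
Proof. by move=> S; exact: boundedOpP. Qed.
Fact comp_op1 : right_id id_op comp_op.
Proof. by move=> S; exact: boundedOpP. Qed.
Fact comp_opDl : left_distributive comp_op +%R.
Proof. by move=> S T U; exact: boundedOpP. Qed.
Fact comp_opDr : right_distributive comp_op +%R.
Proof. by move=> S T U; apply: boundedOpP => x; exact: linearD. Qed.
(** [H] may be the zero space, hence [pzRing] and not [nzRing]. *)
HB.instance Definition _ := GRing.Zmodule_isPzRing.Build (boundedOp H)
  comp_opA comp_1op comp_op1 comp_opDl comp_opDr.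

Lemma zero_opE x : (0 : boundedOp H) x = 0. Proof. by []. Qed.
Lemma one_opE x : (1 : boundedOp H) x = x. Proof. by []. Qed.
Lemma add_opE S T x : (S + T) x = S x + T x. Proof. by []. Qed.
Lemma opp_opE S x : (- S) x = - S x. Proof. by []. Qed.
Lemma mul_opE S T x : (S * T) x = S (T x). Proof. by []. Qed.

End BoundedOpRing.

Section OperatorOrder.
Context {R : realType} {H : hilbertType R}.
Implicit Types S T U : boundedOp H.

(** In [R[i]], [0 <= z] entails that [z] is real; since [H] is complex, a
    positive operator is therefore selfadjoint. *)
Definition positive_op T : Prop := forall x : H, 0 <= '[T x, x].

Lemma op_form_eq0 T : (forall x, '[T x, x] = 0) -> T = 0.
Proof.
move=> T0.
have sym x y : '[T x, y] + '[T y, x] = 0.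
  have := T0 (x + y).
  by rewrite (linearD T) innerDl !innerDr !T0 add0r addr0.
have Txy x y : '[T x, y] = 0.
  have := sym x (Num.imaginary *: y); rewrite (linearZ_LR T)/= innerZl innerZr conjCi.
  rewrite mulNr addrC -mulrBr => /eqP.
  rewrite mulf_eq0 (negPf (neq0Ci _))/= subr_eq0 => /eqP TyTx.
  have /eqP := sym x y; rewrite TyTx -mulr2n mulrn_eq0/= => /eqP.
  by [].
apply: boundedOpP => x; apply/eqP; rewrite zero_opE -inner_eq0.
by rewrite Txy.
Qed.

Definition le_op S T : bool := `[< positive_op (T - S) >].
Definition lt_op S T : bool := (T != S) && le_op S T.

Fact le_op_refl : reflexive le_op.
Proof. by move=> T; apply/asboolP => x; rewrite subrr inner0l. Qed.

Fact le_op_anti : antisymmetric le_op.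
Proof.
move=> S T /andP[/asboolP ST /asboolP TS]; apply/eqP; rewrite -subr_eq0.
apply/eqP/op_form_eq0 => x; apply/eqP; rewrite eq_le TS andbT.
by rewrite -oppr_ge0 -innerNl -opp_opE opprB ST.
Qed.

Fact le_op_trans : transitive le_op.
Proof.
move=> T S U /asboolP ST /asboolP TU; apply/asboolP => x.
have -> : U - S = (U - T) + (T - S) by rewrite addrA subrK.
by rewrite add_opE innerDl addr_ge0.
Qed.

HB.instance Definition _ := Order.isPOrder.Build ring_display (boundedOp H)
  (fun _ _ => erefl) le_op_refl le_op_anti le_op_trans.

Lemma le_opP S T : reflect (positive_op (T - S)) (S <= T).
Proof. exact: asboolP. Qed.

End OperatorOrder.

Section Adjoint.
Context {R : realType} {H : hilbertType R}.

(** The adjoint exists by the Riesz representation theorem, and is unique, so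
    the default value [0] is never taken. *)
Definition adjoint (T : boundedOp H) : boundedOp H :=
  xget 0 [set S : boundedOp H | forall x y, '[T x, y] = '[x, S y]].

End Adjoint.

Section Shorted.
Context {R : realType} {H : hilbertType R}.

Definition orthocomp (S : set H) : set H :=
  [set y | forall x, S x -> '[x, y] = 0].

Definition shorted_set (W : boundedOp H) (S : set H) : set (boundedOp H) :=
  [set X | 0 <= X <= W /\ range X `<=` orthocomp S].

(** The maximum of [shorted_set W S]; it exists (and is unique) whenever [W] is
    positive and [S] is a closed subspace, and the value is [0] if there is no
    maximum. *)
Definition shorted (W : boundedOp H) (S : set H) : boundedOp H :=
  xget 0 (shorted_set W S `&` ubound (shorted_set W S)).

End Shorted.

(* Main.v *)
From HB Require Import structures.
Require Import Defs.
From mathcomp Require Import all_boot all_order all_algebra complex.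
From mathcomp Require Import all_classical all_reals topology normedtype.
From mathcomp Require Import ring lra.
Import Order.TTheory GRing.Theory Num.Theory.
Import numFieldNormedType.Exports.
Local Open Scope classical_set_scope.
Local Open Scope ring_scope.

(** Both sides of the identity are governed by one quadratic form,
      q x = inf (a in R(A)) <W (x + a), x + a>.

    On the one hand <F X x, x> = <W (x - A X x), x - A X x>, which is at least
    q x. For a fixed nonzero x and any y there is an operator X of rank one with
    X x = y, so a lower bound L of all the F X satisfies
    <L x, x> <= <W (x + a), x + a> for every a in R(A), that is
    <L x, x> <= q x. Hence an operator whose quadratic form is q is the infimum.

    On the other hand, if 0 <= Y <= W and R(Y) is orthogonal to R(A), then Y
    kills R(A), so <Y x, x> = <Y (x + a), x + a> <= <W (x + a), x + a> and
    <Y x, x> <= q x. Hence an operator with quadratic form q and with range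
    orthogonal to R(A) is also the shorted operator.

    What remains is to construct such an operator S for a linear subspace M
    ([short_op_ex]). If x + a_n is a minimising sequence for q x, the
    parallelogram law makes it Cauchy for the seminorm of W, and by
    Cauchy-Schwarz W (x + a_n) is then Cauchy in H. Its limit S x does not
    depend on the sequence and is linear in x; it is orthogonal to M because
    minimisers are, and its pairing with x is q x. This avoids the square root
    of W.

    The adjoint in the definition of F requires the Riesz representation
    theorem, which is again a case of [short_op_ex]: with W = 1 and M the kernel
    of a functional f, the vector S x0 represents f up to a scalar as soon as
    f x0 = 1. *)

(** * The real inner product and completeness *)

Section RealInner.
Context {R : realType} {H : hilbertType R}.
Implicit Types (x y z u v : H) (t : R) (T : boundedOp H).

(** All estimates are made with the real part of the inner product, so that they
    take place in the ordered field [R]; [inner_rinner] recovers the complex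
    value. *)
Definition rinner x y : R := complex.Re '[x, y].
Local Notation r := rinner.

Lemma rinnerC x y : r x y = r y x.
Proof. by rewrite /rinner innerC; case: '[y, x]. Qed.

Lemma rinnerDl x y z : r (x + y) z = r x z + r y z.
Proof. by rewrite /rinner innerDl; case: '[x, z] => ? ?; case: '[y, z]. Qed.

Lemma rinnerDr x y z : r z (x + y) = r z x + r z y.
Proof. by rewrite !(rinnerC z) rinnerDl. Qed.

Lemma rinnerNl x y : r (- x) y = - r x y.
Proof. by rewrite /rinner innerNl; case: '[x, y]. Qed.

Lemma rinnerNr x y : r x (- y) = - r x y.
Proof. by rewrite !(rinnerC x) rinnerNl. Qed.

Lemma rinnerBl x y z : r (x - y) z = r x z - r y z.
Proof. by rewrite rinnerDl rinnerNl. Qed.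

Lemma rinnerZl t x y : r (t%:C%C *: x) y = t * r x y.
Proof.
by rewrite /rinner innerZl; case: '[x, y] => a b /=; rewrite mul0r subr0.
Qed.

Lemma rinnerZr t x y : r x (t%:C%C *: y) = t * r x y.
Proof. by rewrite !(rinnerC x) rinnerZl. Qed.

Lemma rinner_scale (c : R[i]) x y : r (c *: x) y = r x ((c^*)%C *: y).
Proof. by rewrite /rinner innerZl innerZr -[Num.conj _]/((c^*)^*)%C conjcK. Qed.

Lemma Im_inner x y : complex.Im '[x, y] = r x ('i%C *: y).
Proof.
rewrite /rinner innerZr -[Num.conj _]/(('i%C : R[i])^*)%C.
by case: '[x, y] => a b /=; ring.
Qed.

Lemma inner_rinner x y : '[x, y] = Complex (r x y) (r x ('i%C *: y)).
Proof. by rewrite -Im_inner /rinner; case: '[x, y]. Qed.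

Lemma scaleii x : 'i%C *: ('i%C *: x) = - x.
Proof. by rewrite scalerA -expr2 sqr_i scaleN1r. Qed.

Lemma rinnerZZ (c : R[i]) x y :
  r (c *: x) (c *: y) = (complex.Re c ^+ 2 + complex.Im c ^+ 2) * r x y.
Proof.
rewrite rinner_scale scalerA.
suff -> : (c^*)%C * c = (complex.Re c ^+ 2 + complex.Im c ^+ 2)%:C%C.
  by rewrite rinnerZr.
case: c => a b; apply/eqP; rewrite eq_complex /=.
by apply/andP; split; apply/eqP; ring.
Qed.

Lemma rinnerii x y : r ('i%C *: x) ('i%C *: y) = r x y.
Proof. by rewrite rinnerZZ/= expr0n add0r expr1n mul1r. Qed.

Lemma sqr_normC x : `|x| ^+ 2 = (r x x)%:C%C.
Proof.
rewrite sqr_normE /rinner RRe_real// -sqr_normE.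
by rewrite realE exprn_ge0.
Qed.

Lemma rinner_ge0 x : 0 <= r x x.
Proof. by rewrite -ler0c -sqr_normC exprn_ge0. Qed.

Lemma rinner_eq0 x : r x x = 0 -> x = 0.
Proof.
move=> x0; apply/eqP; rewrite -normr_eq0 -sqrf_eq0 sqr_normC x0.
by [].
Qed.

Lemma norm_sqrt x : `|x| = (Num.sqrt (r x x))%:C%C.
Proof.
apply/eqP; rewrite -(eqrXn2 (n := 2))// ?ler0c ?sqrtr_ge0//.
by rewrite sqr_normC -rmorphXn/= sqr_sqrtr ?rinner_ge0.
Qed.

(** A quadratic polynomial that is nonnegative on the whole line has nonpositive
    discriminant. Both the Cauchy-Schwarz inequality and the near orthogonality
    of near minimisers are instances. *)
Lemma quadratic_ge0_discr (a b c : R) :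
  (forall t, 0 <= a + t * b *+ 2 + t ^+ 2 * c) -> b ^+ 2 <= a * c.
Proof.
move=> h.
have a0 : 0 <= a by have := h 0; rewrite mul0r mul0rn expr0n mul0r !addr0.
have [c0|c0] := eqVneq c 0.
  rewrite c0 mulr0; have [-> |b0] := eqVneq b 0; first by rewrite expr0n.
  (* the affine function a + 2 t b takes the value -1 here *)
  have := h (- (a + 1) / (2 * b)); rewrite c0 mulr0 addr0.
  have -> : a + - (a + 1) / (2 * b) * b *+ 2 = - 1 by field.
  by rewrite lerNr oppr0 lt_geF.
have cp : 0 < c.
  rewrite lt_neqAle eq_sym c0/= leNgt; apply/negP => cn.
  (* for c < 0 one of t and - t violates h once t is this large *)
  pose t := (1 + a + `|b|) / - c + 1.
  have t1 : 1 <= t by rewrite lerDr divr_ge0// ?addr_ge0// oppr_ge0 ltW.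
  have tc : t * - c = 1 + a + `|b| - c by rewrite /t; field.
  have h1 := h t; have h2 := h (- t).
  have : t ^+ 2 * c = - (t * (1 + a + `|b| - c)) by rewrite -tc; ring.
  have bb := normr_ge0 b.
  move=> e; rewrite sqrrN in h2; rewrite !e in h1 h2.
  nra.
(* the minimum of the polynomial *)
have := h (- b / c).
have -> : a + - b / c * b *+ 2 + (- b / c) ^+ 2 * c = (a * c - b ^+ 2) / c.
  by field.
by rewrite pmulr_lge0 ?invr_gt0// subr_ge0.
Qed.

Lemma bounded_opP T :
  exists2 K : R, 0 < K & forall x, r (T x) (T x) <= K * r x x.
Proof.
have : continuous T by exact: cts_fun.
move=> /linear_bounded_continuous/linear_boundedP/pinfty_ex_gt0 [k k0 kT].
have kR : k = (complex.Re k)%:C%C by rewrite RRe_real// gtr0_real.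
exists (complex.Re k ^+ 2).
  by rewrite exprn_gt0// -ltcR -kR.
move=> x; rewrite -lecR rmorphM rmorphXn/= -kR -!sqr_normC -exprMn.
by apply: lerXn2r; rewrite ?nnegrE ?kT// mulr_ge0// ltW.
Qed.

(** Operators are constructed below as linear maps satisfying an estimate
    between squared norms. *)
Lemma bounded_op_ex (f : H -> H) (K : R) : linear f ->
  (forall x, r (f x) (f x) <= K * r x x) -> exists T : boundedOp H, T =1 f.
Proof.
move=> lf fK.
pose L : {linear H -> H} := HB.pack f (GRing.isLinear.Build _ _ _ _ f lf).
suff cf : continuous f by exists (BoundedOpOf lf cf).
apply/(linear_bounded_continuous L)/ex_bound.
exists (Num.sqrt `|K|)%:C%C; apply/nbhs_norm0P; exists 1 => //= x.
rewrite /= !norm_sqrt ltcR lecR => x1; rewrite ler_wsqrtr//.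
have {x1} : Num.sqrt (r x x) < Num.sqrt 1 by rewrite sqrtr1.
rewrite ltr_sqrt// => x1.
apply: (le_trans (fK x)); apply: (@le_trans _ _ (`|K| * r x x)).
  by rewrite ler_wpM2r ?rinner_ge0// ler_norm.
by rewrite ler_piMr// ltW.
Qed.

Lemma sqrt_lt_half (a e : R) : 0 < e -> a <= (e / 2) ^+ 2 -> Num.sqrt a < e.
Proof.
move=> e0 /ler_wsqrtr; rewrite sqrtr_sqr => /le_lt_trans; apply.
by rewrite gtr0_norm ?divr_gt0//; lra.
Qed.

Lemma hilbert_complete (u : nat -> H) :
  (forall e : R, 0 < e -> exists n0, forall n m, (n0 <= n)%N -> (n0 <= m)%N ->
     r (u n - u m) (u n - u m) <= e) ->
  exists z, forall e : R, 0 < e -> exists n0, forall n, (n0 <= n)%N ->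
     r (z - u n) (z - u n) <= e.
Proof.
move=> uC.
have /cauchy_cvgP/cvg_ex[z uz] : cauchy (u @ \oo).
  apply/cauchy_ballP => e e0.
  have eR : e = (complex.Re e)%:C%C by rewrite RRe_real// gtr0_real.
  have e0' : 0 < complex.Re e by rewrite -ltcR -eR.
  have [n0 un0] := uC _ (exprn_gt0 2 (divr_gt0 e0' (ltr0Sn R 1))).
  rewrite near_map2; exists ([set n | (n0 <= n)%N],
    [set n | (n0 <= n)%N]) => /=.
    by split; exists n0.
  move=> [n m] /= [hn hm]; rewrite -ball_normE /=.
  by rewrite eR norm_sqrt ltcR sqrt_lt_half// un0.
exists z => e e0; have /cvgrPdist_lt/(_ (Num.sqrt e)%:C%C) := uz.
rewrite ltcR sqrtr_gt0 => /(_ e0) [n0 _ un0]; exists n0 => n /un0 /=.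
by rewrite norm_sqrt ltcR ltr_sqrt// => /ltW.
Qed.
End RealInner.

(** * Positive operators *)

Definition rinnerE {R : realType} {H : hilbertType R} :=
  (@rinnerDl R H, @rinnerDr R H, @rinnerNl R H, @rinnerNr R H).

Section Positive.
Context {R : realType} {H : hilbertType R}.
Implicit Types (x y z u v : H) (t : R) (W : boundedOp H).
Local Notation r := rinner.

Lemma positive_inner W x : positive_op W -> '[W x, x] = (r (W x) x)%:C%C.
Proof. by move=> W0; rewrite /rinner RRe_real// realE W0. Qed.

Lemma positive_rinner_ge0 W x : positive_op W -> 0 <= r (W x) x.
Proof. by move=> W0; rewrite -ler0c -positive_inner. Qed.

(** Polarisation: <W v, v> is real for every v, and applying this to sums and to
    multiples by the imaginary unit forces symmetry. *)
Lemma positive_sym W x y : positive_op W -> r (W x) y = r x (W y).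
Proof.
move=> W0.
have im0 v : r (W v) ('i%C *: v) = 0.
  by rewrite -Im_inner positive_inner.
have sym u v : r (W u) ('i%C *: v) + r (W v) ('i%C *: u) = 0.
  have := im0 (u + v); rewrite linearD scalerDr !rinnerE !im0.
  by rewrite add0r addr0.
have := sym x ('i%C *: y); rewrite scaleii linearZ/= rinnerii rinnerNr.
rewrite (rinnerC x) => e; lra.
Qed.

Lemma positive_cauchy W x y : positive_op W ->
  r (W x) y ^+ 2 <= r (W x) x * r (W y) y.
Proof.
move=> W0; apply: quadratic_ge0_discr => t.
have := positive_rinner_ge0 W (x + t%:C%C *: y) W0.
rewrite linearD linearZ/= !rinnerE !(rinnerZl, rinnerZr).
rewrite (positive_sym W y x)// (rinnerC y) => h; lra.
Qed.

Lemma one_positive : positive_op (1 : boundedOp H).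
Proof. by move=> v; rewrite one_opE -sqr_normE exprn_ge0. Qed.

Lemma rinner_cauchy x y : r x y ^+ 2 <= r x x * r y y.
Proof. exact: positive_cauchy one_positive. Qed.

(** The bound follows from expanding 0 <= |W x - x|^2. *)
Lemma positive_bound W : positive_op W ->
  exists2 K : R, 0 < K & forall x, r (W x) x <= K * r x x.
Proof.
move=> W0; have [K K0 WK] := bounded_opP W; exists (K + 1); first lra.
move=> x; have := rinner_ge0 (W x - x); rewrite !rinnerE (rinnerC x).
have := WK x; have := rinner_ge0 x; nra.
Qed.

End Positive.

(** * The shorted quadratic form and its operator *)

Section ShortedForm.
Context {R : realType} {H : hilbertType R} (W : boundedOp H) (M : set H).
Hypotheses (W0 : positive_op W) (M0 : M 0)
  (MZD : forall (c : R[i]) a b, M a -> M b -> M (c *: a + b)).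
Implicit Types (x y z u v a b : H) (e t : R) (c : R[i]).
Local Notation r := rinner.
Local Notation w x := (r (W x) x).

Let MD a b : M a -> M b -> M (a + b).
Proof. by move=> Ma Mb; rewrite -[a]scale1r; exact: MZD. Qed.
Let MZ c a : M a -> M (c *: a).
Proof. by move=> Ma; rewrite -[_ *: _]addr0; exact: MZD. Qed.
Let MB a b : M a -> M b -> M (a - b).
Proof. by move=> Ma Mb; rewrite -scaleN1r; exact/MD/MZ. Qed.

Definition short_form x : R := inf [set w (x + a) | a in M].
Local Notation q := short_form.

Let w_ge0 x : 0 <= w x. Proof. exact: positive_rinner_ge0. Qed.

Let wZ c x : w (c *: x) = (complex.Re c ^+ 2 + complex.Im c ^+ 2) * w x.
Proof. by rewrite linearZ/= rinnerZZ. Qed.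

Let w_par x y : w (x + y) + w (x - y) = 2 * (w x + w y).
Proof. by rewrite linearB linearD !rinnerE; ring. Qed.

Let w_double x : w (x + x) = 4 * w x.
Proof. by rewrite linearD !rinnerE; ring. Qed.

Lemma short_form_lb x a : M a -> q x <= w (x + a).
Proof.
move=> Ma; apply: ge_inf; last by exists a.
by exists 0 => _ [b _ <-]; exact: w_ge0.
Qed.

Lemma short_form_glb x t : (forall a, M a -> t <= w (x + a)) -> t <= q x.
Proof.
move=> h; apply: lb_le_inf; first by exists (w (x + 0)), 0.
by move=> _ [a Ma <-]; exact: h.
Qed.

Lemma short_form_ge0 x : 0 <= q x.
Proof. by apply: short_form_glb => a _; exact: w_ge0. Qed.

Lemma short_form_le x : q x <= w x.
Proof. by rewrite -[x in w x]addr0; exact: short_form_lb. Qed.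

Lemma short_form_near x e : 0 < e -> exists2 a, M a & w (x + a) <= q x + e.
Proof.
move=> e0.
have [||_ [a Ma <-] lt] := @inf_lt _ [set w (x + a) | a in M] (q x + e).
- by exists (w (x + 0)), 0.
- by rewrite ltrDl.
- by exists a => //; exact: ltW.
Qed.

(** The midpoint of two points of x + M is again in x + M. *)
Let short_form_lb2 x a : M a -> 4 * q x <= w (x + x + a).
Proof.
move=> Ma; pose h := (2^-1 : R)%:C%C *: a.
have -> : a = h + h.
  rewrite -scalerDl -rmorphD/= (_ : 2^-1 + 2^-1 = 1 :> R) ?scale1r//; lra.
rewrite addrACA w_double ler_pM2l//.
exact/short_form_lb/MZ.
Qed.

(** One half of the parallelogram law for [short_form]; the additivity of limits
    of minimising sequences rests on it. *)
Lemma short_form_par x y : 2 * (q x + q y) <= q (x + y) + q (x - y).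
Proof.
apply/ler_addgt0Pr => e e0.
have e1 : 0 < e / 2 by lra.
have [a Ma ha] := short_form_near (x + y) _ e1.
have [b Mb hb] := short_form_near (x - y) _ e1.
have := short_form_lb2 x _ (MD _ _ Ma Mb).
have := short_form_lb2 y _ (MB _ _ Ma Mb).
have := w_par (x + y + a) (x - y + b).
have -> : x + y + a + (x - y + b) = x + x + (a + b).
  by rewrite addrACA [x + y + _]addrACA subrr addr0.
have -> : x + y + a - (x - y + b) = y + y + (a - b).
  by rewrite opprD addrACA opprB [x + y]addrC [y + x + _]addrACA subrr addr0.
lra.
Qed.

(** Two near minimisers are close in the seminorm of W, by the parallelogram
    law: this is the source of both existence and uniqueness of the limit. *)
Lemma near_dist x a b e : M a -> M b ->
  w (x + a) <= q x + e -> w (x + b) <= q x + e -> w (a - b) <= 4 * e.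
Proof.
move=> Ma Mb ha hb; have := w_par (x + a) (x + b).
have -> : x + a + (x + b) = x + x + (a + b) by rewrite addrACA.
have -> : x + a - (x + b) = a - b by rewrite opprD addrACA subrr add0r.
have := short_form_lb2 x _ (MD _ _ Ma Mb); lra.
Qed.

(** The first-order condition at a near minimiser, in quantitative form. *)
Lemma near_orth x a b e : M a -> M b -> w (x + a) <= q x + e ->
  r (W (x + a)) b ^+ 2 <= e * w b.
Proof.
move=> Ma Mb ha; apply: quadratic_ge0_discr => t.
have := short_form_lb x _ (MD _ _ Ma (MZ t%:C%C _ Mb)).
rewrite addrA; move: (x + a) ha => u ha.
rewrite linearD linearZ/= !rinnerE !(rinnerZl, rinnerZr).
rewrite (positive_sym _ b u)// (rinnerC b); lra.
Qed.

(** The relation between x and the limit z of W (x + a) along minimising a in M.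
    The distance from z to W (x + a) is tested against each v and measured by
    the seminorm of W at v: this form of convergence controls the pairing
    with x + a itself, whose norm may be unbounded along the sequence. *)
Definition short_limit x z := forall e, 0 < e -> exists a,
  [/\ M a, w (x + a) <= q x + e
    & forall v, r (z - W (x + a)) v ^+ 2 <= e * w v].

Let sqr0_le t (B : R) : (forall e, 0 < e -> t ^+ 2 <= e * B) -> t = 0.
Proof.
move=> h; apply/eqP; rewrite -sqrf_eq0 eq_le sqr_ge0 andbT.
apply/ler_addgt0Pr => e e0; rewrite add0r.
have B1 : 0 < `|B| + 1 by rewrite ltr_wpDl.
apply: (le_trans (h (e / (`|B| + 1)) _)); first exact: divr_gt0.
rewrite mulrAC ler_pdivrMr// ler_pM2l//.
by have := ler_norm B; lra.
Qed.

Let rinner_inj z : (forall v, r z v = 0) -> z = 0.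
Proof. by move=> h; exact: rinner_eq0. Qed.

Lemma short_limit_ex x : exists z, short_limit x z.
Proof.
have [K K0 WK] := positive_bound _ W0.
pose e n : R := n.+1%:R^-1.
have e0 n : 0 < e n by rewrite invr_gt0.
have eS n m : (n <= m)%N -> e m <= e n.
  by move=> nm; rewrite lef_pV2 ?posrE// ler_nat.
have e_small d : 0 < d -> exists n, e n <= d.
  move=> d0; have d1 : 0 <= d^-1 by rewrite invr_ge0 ltW.
  exists (Num.bound d^-1); rewrite /e -[leRHS]invrK lef_pV2 ?posrE ?invr_gt0//.
  by rewrite (le_trans (ltW (archi_boundP d1)))// ler_nat.
have /choice[a_ a_P] : forall n, exists a, M a /\ w (x + a) <= q x + e n.
  by move=> n; have [a] := short_form_near x _ (e0 n); exists a.
have dist n m : (n <= m)%N -> w (a_ m - a_ n) <= 4 * e n.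
  move=> nm; have [Ma ha] := a_P m; have [Mb hb] := a_P n.
  apply: (@near_dist x) => //; apply: (le_trans ha).
  by rewrite lerD2l eS.
(* Cauchy-Schwarz for W turns the seminorm estimate into a weak one *)
have Wdist n m v : (n <= m)%N ->
    r (W (x + a_ m) - W (x + a_ n)) v ^+ 2 <= 4 * e n * w v.
  move=> nm; rewrite -linearB opprD addrACA subrr add0r.
  apply: (le_trans (positive_cauchy _ _ _ W0)).
  by rewrite ler_wpM2r// dist.
(* and into one for the norm, testing against the difference itself *)
have Ndist n m d : (n <= m)%N -> d = W (x + a_ m) - W (x + a_ n) ->
    r d d <= 4 * K * e n.
  move=> nm dE; have := Wdist _ _ d nm; rewrite -dE => h.
  have := WK d; have := rinner_ge0 d; have := e0 n; move: h.
  move: (r d d) (r (W d) d) => N D h en N0 ND.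
  have [->|Nn0] := eqVneq N 0; first by rewrite !mulr_ge0// ltW.
  have Np : 0 < N by rewrite lt_neqAle eq_sym Nn0.
  rewrite -(ler_pM2r Np); nra.
have [|z zP] := hilbert_complete (fun n => W (x + a_ n)).
  move=> d d0; have K4 : 0 < 4 * K by rewrite mulr_gt0.
  have [n0 en0] := e_small _ (divr_gt0 d0 K4).
  have en0' n : (n0 <= n)%N -> 4 * K * e n <= d.
    move=> /eS/le_trans/(_ en0); rewrite ler_pdivlMr; last by rewrite mulr_gt0.
    by rewrite mulrC.
  exists n0 => n m hn hm; case/orP: (leq_total n m) => nm.
    rewrite -opprB rinnerNl rinnerNr opprK.
    exact: (le_trans (Ndist _ _ _ nm erefl) (en0' _ hn)).
  exact: (le_trans (Ndist _ _ _ nm erefl) (en0' _ hm)).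
exists z => d d0; have [n en] := e_small (d / 8) ltac:(lra).
have [Man han] := a_P n.
exists (a_ n); split => //.
  by apply: (le_trans han); lra.
move=> v.
apply/ler_addgt0Pr => f f0.
have Nv1 : 0 < 2 * (r v v + 1) by have := rinner_ge0 v; lra.
have [m0 hm0] := zP (f / (2 * (r v v + 1))) (divr_gt0 f0 Nv1).
(* compare z with W (x + a_ n) through a later term of the sequence *)
pose m := maxn m0 n.
have h1 := hm0 m (leq_maxl _ _).
have h2 := Wdist n m v (leq_maxr _ _).
rewrite -(subrKA (W (x + a_ m))) rinnerDl.
have h3 := rinner_cauchy (z - W (x + a_ m)) v.
have wv := w_ge0 v; have Nv := rinner_ge0 v.
have h4 : 4 * e n * w v <= d / 2 * w v by apply: ler_wpM2r => //; lra.
have h5 : f / (2 * (r v v + 1)) * r v v <= f / 2.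
  rewrite mulrAC ler_pdivrMr//; nra.
have := ler_wpM2r Nv h1.
have := sqr_ge0 (r (z - W (x + a_ m)) v - r (W (x + a_ m) - W (x + a_ n)) v).
lra.
Qed.

Lemma short_limit_uniq x z z' : short_limit x z -> short_limit x z' -> z = z'.
Proof.
move=> zP z'P; apply/eqP; rewrite -subr_eq0; apply/eqP/rinner_inj => v.
apply: (@sqr0_le _ (18 * w v)) => e e0.
have [a [Ma ha za]] := zP _ e0; have [b [Mb hb zb]] := z'P _ e0.
have := le_trans (positive_cauchy _ (a - b) v W0)
  (ler_wpM2r (w_ge0 v) (near_dist _ _ _ _ Ma Mb ha hb)).
have -> : W (a - b) = W (x + a) - W (x + b).
  by rewrite -linearB opprD addrACA subrr add0r.
have := za v; have := zb v.
rewrite !rinnerBl; set p1 := r z v; set p2 := r z' v.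
set p3 := r (W (x + a)) v; set p4 := r (W (x + b)) v.
(* p1 - p2 = (p1 - p3) - (p2 - p4) + (p3 - p4), and the square of a sum of three
   terms is at most three times the sum of the squares *)
have := sqr_ge0 ((p1 - p3) + (p2 - p4)).
have := sqr_ge0 ((p1 - p3) - (p3 - p4)).
have := sqr_ge0 ((p2 - p4) + (p3 - p4)).
nra.
Qed.

(** The sum of two near minimisers is a near minimiser for the sum: by the
    parallelogram law it cannot be far above [short_form (x + y)], since the
    difference is bounded below by [short_form (x - y)]. *)
Lemma short_limitD x y z z' : short_limit x z -> short_limit y z' ->
  short_limit (x + y) (z + z').
Proof.
move=> zP z'P e e0; have e4 : 0 < e / 4 by lra.
have [a [Ma ha za]] := zP _ e4; have [b [Mb hb zb]] := z'P _ e4.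
exists (a + b); split; first exact: MD.
  have := w_par (x + a) (y + b).
  rewrite addrACA.
  have -> : x + a - (y + b) = x - y + (a - b) by rewrite opprD addrACA.
  have := short_form_lb (x - y) _ (MB _ _ Ma Mb).
  have := short_form_par x y; lra.
move=> v; rewrite addrACA linearD opprD addrACA rinnerDl.
have := za v; have := zb v; nra.
Qed.

Lemma short_limitZ c x z : short_limit x z -> short_limit (c *: x) (c *: z).
Proof.
move=> zP e e0.
pose C := complex.Re c ^+ 2 + complex.Im c ^+ 2.
have C0 : 0 <= C by rewrite addr_ge0 ?sqr_ge0.
have d0 : 0 < e / (C + 1) by apply: divr_gt0; lra.
have [a [Ma ha za]] := zP _ d0; exists (c *: a).
have Ce : C * (e / (C + 1)) <= e.
  by rewrite mulrA ler_pdivrMr; nra.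
have qc : C * q x <= q (c *: x).
  apply: short_form_glb => b Mb; have [c0|c0] := eqVneq c 0.
    by rewrite /C c0/= expr0n addr0 mul0r w_ge0.
  rewrite -[b](scalerKV c0) -scalerDr wZ ler_wpM2l//.
  exact/short_form_lb/MZ.
rewrite -scalerDr; split; first exact: MZ.
  rewrite wZ -/C; apply: le_trans (ler_wpM2l C0 ha) _; lra.
move=> v; rewrite linearZ -scalerBr rinner_scale.
apply: (le_trans (za _)); rewrite wZ.
have -> : complex.Re (c^*)%C ^+ 2 + complex.Im (c^*)%C ^+ 2 = C.
  by rewrite /C; case: (c) => ? ? /=; rewrite sqrrN.
rewrite mulrA [_ * C]mulrC ler_wpM2r//.
Qed.

Lemma short_limit_orth x z b : short_limit x z -> M b -> '[b, z] = 0.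
Proof.
move=> zP Mb.
have re0 b' : M b' -> r z b' = 0.
  move=> Mb'; apply: (@sqr0_le _ (4 * w b')) => e e0.
  have [a [Ma ha /(_ b')]] := zP _ e0.
  have := near_orth _ _ _ _ Ma Mb' ha.
  rewrite rinnerBl; nra.
by rewrite innerC inner_rinner !re0//=; [exact: conjc0|exact: MZ].
Qed.

(** As z is orthogonal to M, its pairing with x equals that with the near
    minimiser u = x + a, which approaches <W u, u>. The imaginary part is read
    off by pairing with the multiple of x by the imaginary unit. *)
Lemma short_limit_val x z : short_limit x z -> '[z, x] = (q x)%:C%C.
Proof.
move=> zP.
have zM b : M b -> r z b = 0.
  by move=> Mb; rewrite rinnerC /rinner (short_limit_orth _ _ _ zP).
have approx c e : 0 < e <= 1 -> exists a, [/\ M a, w (x + a) <= q x + e &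
    (r z (c *: x) - r (W (x + a)) (c *: (x + a))) ^+ 2 <=
    e * ((complex.Re c ^+ 2 + complex.Im c ^+ 2) * (q x + 1))].
  move=> /andP[e0 e1]; have [a [Ma ha za]] := zP _ e0; exists a; split => //.
  have -> : r z (c *: x) = r z (c *: (x + a)).
    by rewrite scalerDr rinnerDr (zM (c *: a)) ?addr0//; exact: MZ.
  rewrite -rinnerBl; apply: le_trans (za _) _.
  rewrite ler_pM2l// wZ ler_wpM2l ?addr_ge0 ?sqr_ge0//; lra.
rewrite inner_rinner; congr Complex.
  apply/eqP; rewrite -subr_eq0; apply/eqP.
  apply: (@sqr0_le _ (2 * q x + 4)) => e e0.
  have d01 : 0 < Num.min e 1 <= 1 by rewrite lt_min e0 ltr01 ge_min lexx orbT.
  have [a [Ma ha]] := approx 1 _ d01; rewrite !scale1r/= => h.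
  have := short_form_lb x _ Ma; have := short_form_ge0 x.
  have de : Num.min e 1 <= e by rewrite ge_min lexx.
  move: (Num.min e 1) d01 de ha h => d /andP[d0 d1] de.
  move: (r z x) (q x) (w (x + a)) => zx Q wu h1 h2 Q0 h3.
  apply: (@le_trans _ _ (d * (2 * Q + 4))); last by rewrite ler_wpM2r//; lra.
  have h4 : (wu - Q) ^+ 2 <= d by nra.
  by have := sqr_ge0 (zx - wu - (wu - Q)); lra.
apply: (@sqr0_le _ (q x + 1)) => e e0.
have [|a [Ma _]] := approx 'i%C (Num.min e 1).
  by rewrite lt_min e0 ltr01 ge_min lexx orbT.
rewrite -[r (W _) _]Im_inner positive_inner// subr0/= expr0n add0r expr1n mul1r.
move=> /le_trans; apply; rewrite ler_wpM2r ?ge_min ?lexx//.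
by rewrite addr_ge0// short_form_ge0.
Qed.

(** With v = z this bounds z, hence the operator, by the form. *)
Lemma short_limit_bound x z v : short_limit x z -> r z v ^+ 2 <= 2 * q x * w v.
Proof.
move=> zP.
apply/ler_addgt0Pr => f f0.
have wv1 : 0 < 4 * (w v + 1) by have := w_ge0 v; lra.
have [a [Ma ha /(_ v) za]] := zP _ (divr_gt0 f0 wv1).
have := positive_cauchy _ (x + a) v W0.
move: ha za; rewrite rinnerBl; set p := r z v; set s := r (W (x + a)) v.
set d := f / (4 * (w v + 1)) => ha za h.
have dd : d * (4 * (w v + 1)) = f by rewrite /d divfK// gt_eqF.
have d0 : 0 < d by exact: divr_gt0.
have wv := w_ge0 v.
have h2 := ler_wpM2r wv ha.
(* p^2 <= 2 (p - s)^2 + 2 s^2 *)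
have := sqr_ge0 (p - s *+ 2).
nra.
Qed.

Lemma short_op_ex : exists S : boundedOp H,
  (forall x, '[S x, x] = (q x)%:C%C) /\ range S `<=` orthocomp M.
Proof.
have [S SP] := choice short_limit_ex.
have S_lin : linear S.
  move=> c x y; apply: (@short_limit_uniq (c *: x + y)); first exact: SP.
  by apply/short_limitD/SP/short_limitZ/SP.
have [K K0 WK] := positive_bound _ W0.
have [|S' S'E] := @bounded_op_ex _ _ S (2 * K ^+ 2) S_lin.
  move=> x; have := short_limit_bound _ _ (S x) (SP x).
  have := WK (S x); have := WK x; have := short_form_le x.
  have := short_form_ge0 x; have := rinner_ge0 x; have := rinner_ge0 (S x).
  move: (r (S x) (S x)) (r x x) (q x) (w x) (w (S x)).
  move=> N n Q wx wS N0 n0 Q0 Qw wn wN h.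
  have [->|Nn0] := eqVneq N 0; first by rewrite !mulr_ge0// ltW.
  have Np : 0 < N by rewrite lt_neqAle eq_sym Nn0.
  rewrite -(ler_pM2r Np) -expr2; apply: (le_trans h).
  have -> : 2 * K ^+ 2 * n * N = 2 * (K * n) * (K * N) by ring.
  apply: (@le_trans _ _ (2 * Q * (K * N))).
    by rewrite ler_wpM2l// mulr_ge0.
  by rewrite ler_wpM2r ?mulr_ge0 ?(ltW K0)//; lra.
exists S'; split; first by move=> x; rewrite S'E; exact: short_limit_val.
by move=> _ [x _ <-] b Mb; rewrite S'E; exact: short_limit_orth (SP x) Mb.
Qed.
End ShortedForm.

(** * Riesz representation, adjoints and rank-one operators *)

Section Riesz.
Context {R : realType} {H : hilbertType R}.
Implicit Types (x y z u v : H) (c : R[i]) (T : boundedOp H).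
Local Notation r := rinner.

(** The representing vector is orthogonal to the kernel M of f, so it can be
    found by shorting the identity to M: if f x0 = 1, then x - f x *: x0 lies
    in M and S x0 is orthogonal to it. Boundedness of f ensures that x0 is at
    positive distance from M, that is q x0 > 0. *)
Lemma riesz (f : H -> R[i]) (K : R) :
  (forall c x y, f (c *: x + y) = c * f x + f y) ->
  (forall x, complex.Re (f x) ^+ 2 <= K * r x x) ->
  exists z, forall x, f x = '[x, z].
Proof.
move=> lf fK.
have f0 : f 0 = 0 by have := lf (- 1) 0 0; rewrite scaler0 addr0 mulN1r addNr.
have [f_0|/existsNP[x1 /eqP fx1]] := pselect (forall x, f x = 0).
  by exists 0 => x; rewrite f_0 innerC inner0l; exact/esym/conjc0.
pose x0 := (f x1)^-1 *: x1.
have fx0 : f x0 = 1 by rewrite /x0 -[_ *: _]addr0 lf f0 addr0 mulVf.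
pose M := [set x | f x = 0].
have MZD c a b : M a -> M b -> M (c *: a + b).
  by rewrite /M/= lf => -> ->; rewrite mulr0 addr0.
have [S [Sq SM]] := short_op_ex 1 M one_positive f0 MZD.
set q := short_form 1 M in Sq.
have Kp : 0 < K.
  have := fK x0; rewrite fx0/= expr1n; have := rinner_ge0 x0; nra.
have q0 : 0 < q x0.
  apply: (@lt_le_trans _ _ K^-1); first by rewrite invr_gt0.
  apply: short_form_glb => // a Ma; rewrite one_opE.
  have := fK (x0 + a).
  rewrite addrC -{1}[a]scale1r lf Ma mulr0 add0r fx0/= expr1n.
  by rewrite mulrC -ler_pdivrMr// div1r.
have qi : (q x0)%:C%C != 0 :> R[i] by rewrite (inj_eq (@complexI R) _ 0) gt_eqF.
exists (((q x0)^-1)%:C%C *: S x0) => x.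
have : '[(- f x) *: x0 + x, S x0] = 0.
  by apply: SM; [exists x0|rewrite /M/= lf fx0 mulr1 addNr].
rewrite innerDl innerZl (innerC x0) Sq innerZr.
rewrite -![Num.conj _]/((_ : R[i])^*)%C !conjc_real mulNr addrC => /subr0_eq ->.
by rewrite fmorphV/= mulrC mulfK.
Qed.

Lemma rank_one_ex x y : x != 0 -> exists X : boundedOp H, X x = y.
Proof.
move=> x0.
pose g v := '[v, x] / '[x, x].
have gx : g x = 1 by rewrite /g mulfV// inner_eq0.
suff [X XE] : exists X : boundedOp H, X =1 (fun v => g v *: y).
  by exists X; rewrite XE gx scale1r.
apply: (@bounded_op_ex _ _ _ (2 * r y y / r x x)).
  by move=> c u v; rewrite /g innerDl innerZl mulrDl scalerDl -mulrA scalerA.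
move=> v; have xp : 0 < r x x.
  rewrite lt_neqAle rinner_ge0 andbT eq_sym.
  exact: contra_neq (@rinner_eq0 _ _ x) x0.
have -> : g v = (r x x)^-1%:C%C * '[v, x].
  by rewrite mulrC fmorphV/= /g -sqr_normE sqr_normC.
rewrite -scalerA rinnerZl rinnerZr rinnerZZ.
have h1 := rinner_cauchy v x; have h2 := rinner_cauchy v ('i%C *: x).
rewrite rinnerii -Im_inner in h2.
have h3 : (complex.Re '[v, x] ^+ 2 + complex.Im '[v, x] ^+ 2) * r y y <=
    2 * (r v v * r x x) * r y y.
  by rewrite ler_wpM2r ?rinner_ge0//; rewrite /rinner in h1 h2 *; lra.
rewrite mulrA -expr2 exprVn mulrC ler_pdivrMr ?exprn_gt0//.
apply: (le_trans h3); rewrite le_eqVlt; apply/orP; left; apply/eqP; field.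
by rewrite gt_eqF.
Qed.

Lemma adjoint_ex T : exists S : boundedOp H, forall x y, '[T x, y] = '[x, S y].
Proof.
have [K K0 TK] := bounded_opP T.
have /choice[S SP] : forall y, exists z, forall x, '[T x, y] = '[x, z].
  move=> y; apply: (@riesz _ (K * r y y)).
    by move=> c u v; rewrite linearP innerDl innerZl.
  move=> x; apply: le_trans (rinner_cauchy _ _) _.
  by rewrite mulrAC ler_wpM2r ?rinner_ge0.
have [||S' S'E] := @bounded_op_ex _ _ S K.
- move=> c u v; apply/eqP; rewrite -subr_eq0 -inner_eq0; apply/eqP.
  set d := _ - _; rewrite {2}/d.
  rewrite innerDr -scaleN1r innerZr !innerDr innerZr -!SP innerDr innerZr.
  by rewrite rmorphN1 mulN1r subrr.
- move=> y.
  have := rinner_cauchy (T (S y)) y.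
  have -> : r (T (S y)) y = r (S y) (S y) by rewrite /rinner SP.
  have := TK (S y); have := rinner_ge0 (S y); have := rinner_ge0 y.
  move: (r (S y) (S y)) (r y y) (r _ _) => N n D n0 N0 DN h.
  have [->|Nn0] := eqVneq N 0; first by rewrite !mulr_ge0// ltW.
  have Np : 0 < N by rewrite lt_neqAle eq_sym Nn0.
  rewrite -(ler_pM2r Np); nra.
by exists S' => x y; rewrite S'E.
Qed.

Lemma adjointP T x y : '[T x, y] = '[x, adjoint T y].
Proof.
move: x y.
exact: (@xgetPex _ 0 [set S : boundedOp H | forall x y, '[T x, y] = '[x, S y]])
  (adjoint_ex T).
Qed.

End Riesz.

(** * The shorted operator and the infimum *)

Section ShortedInf.
Context {R : realType} {H : hilbertType R} (W : boundedOp H) (M : set H).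
Hypotheses (W0 : positive_op W) (M0 : M 0)
  (MZD : forall (c : R[i]) a b, M a -> M b -> M (c *: a + b)).
Local Notation r := rinner.

(** The operator of [short_op_ex] is the maximum in the definition of [shorted]:
    a competitor Y vanishes on M, so its form at v is its form at every v + a,
    which is below that of W. *)
Lemma shorted_inner x : '[shorted W M x, x] = (short_form W M x)%:C%C.
Proof.
have [S [Sq SM]] := short_op_ex W M W0 M0 MZD.
suff SP : (shorted_set W M `&` ubound (shorted_set W M)) S.
  have [h1 h2] := xgetPex 0
    (ex_intro (shorted_set W M `&` ubound (shorted_set W M)) S SP).
  have [S1 S2] := SP.
  have -> : shorted W M = S by apply/le_anti; rewrite (h2 S)// (S2 _ h1).
  exact: Sq.
split; first split => //.
  apply/andP; split; apply/le_opP => v.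
    by rewrite subr0 Sq ler0c short_form_ge0.
  rewrite add_opE opp_opE innerDl innerNl Sq positive_inner// subr_ge0 lecR.
  exact: short_form_le.
move=> Y [/andP[/le_opP Y0 /le_opP YW] YM]; rewrite subr0 in Y0.
apply/le_opP => v.
rewrite add_opE opp_opE innerDl innerNl Sq positive_inner// subr_ge0 lecR.
apply: short_form_glb => // a Ma.
have Ya : Y a = 0.
  apply: rinner_eq0; rewrite positive_sym// /rinner YM//; by exists (Y a).
have := YW (v + a).
rewrite add_opE opp_opE innerDl innerNl !positive_inner// subr_ge0 lecR.
rewrite [in leLHS]linearD/= Ya addr0 rinnerDr (positive_sym Y v a)// Ya.
by rewrite [r v 0]rinnerC /rinner inner0l addr0.
Qed.
End ShortedInf.

Theorem proposition3p1 (R : realType) (H : hilbertType R)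
    (sepH : separable H) (A W : boundedOp H)
    (clA : closed (range A)) (posW : positive_op W) :
  infimums [set adjoint (A * X - 1) * W * (A * X - 1) | X in [set: boundedOp H]]
    (shorted W (range A)).
Proof.
have A0 : range A 0 by exists 0 => //; rewrite linear0.
have AZD (c : R[i]) a b : range A a -> range A b -> range A (c *: a + b).
  by move=> [u _ <-] [v _ <-]; exists (c *: u + v) => //; rewrite linearP.
have Sq := shorted_inner W _ posW A0 AZD.
have FE X x : '[(adjoint (A * X - 1) * W * (A * X - 1)) x, x] =
    (rinner (W (x + A (- X x))) (x + A (- X x)))%:C%C.
  rewrite !mul_opE innerC -adjointP -innerC positive_inner//; congr _%:C%C.
  have -> : (A * X - 1) x = - (x + A (- X x)).
    by rewrite add_opE mul_opE opp_opE one_opE linearN opprB.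
  by rewrite [W (- _)]linearN rinnerNl rinnerNr opprK.
split.
  move=> _ [X _ <-]; apply/le_opP => x.
  rewrite add_opE opp_opE innerDl innerNl FE Sq subr_ge0 lecR.
  by apply: short_form_lb => //; exists (- X x).
move=> L lbL; apply/le_opP => x.
have [->|x0] := eqVneq x 0; first by rewrite innerC inner0l conjC0.
have LF (X : boundedOp H) :
    '[L x, x] <= (rinner (W (x + A (- X x))) (x + A (- X x)))%:C%C.
  have /le_opP/(_ x) :
      (L : boundedOp H) <= adjoint (A * X - 1) * W * (A * X - 1).
    by apply: lbL; exists X.
  by rewrite add_opE opp_opE innerDl innerNl FE subr_ge0.
have LR : '[L x, x] = (rinner (L x) x)%:C%C.
  rewrite /rinner RRe_real//.
  by rewrite (ler_real (LF 0)) realE ler0c positive_rinner_ge0.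
rewrite add_opE opp_opE innerDl innerNl Sq LR subr_ge0 lecR.
apply: short_form_glb => // _ [y _ <-].
have [X Xx] := rank_one_ex x (- y) x0.
by have := LF X; rewrite LR lecR Xx opprK.
Qed.
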